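(* Let $\mathbf{u}=(u_1,\dots,u_N)$ be a control trajectory with $u_t\in\mathcal{U}_t$ for $t=1,\dots,N$. Suppose there exist $\mathbf{x}^u,\mathbf{x}^\ell,\boldsymbol{g}^u_{\mathcal{P}},\boldsymbol{g}^\ell_{\mathcal{P}}\in\mathbb{R}^{|\mathbf{x}|}$ (with the tube and box domain conventions of the context) such that all of the following inequalities hold (componentwise): (i) for every $k=1,\dots,|\mathbf{x}|$, every $\mathbf{x}\in\partial\mathcal{P}$ and every $\mathbf{w}\in\partial\mathcal{W}$, $$\boldsymbol{g}^u_{\mathcal{P},k}\ge \boldsymbol{g}^u_k(\mathbf{x},\mathbf{u},\mathbf{w}),\qquad \boldsymbol{g}^\ell_{\mathcal{P},k}\le \boldsymbol{g}^\ell_k(\mathbf{x},\mathbf{u},\mathbf{w});$$ (ii) $$K^+\boldsymbol{g}^u_{\mathcal{P}}+K^-\boldsymbol{g}^\ell_{\mathcal{P}}+\xi^u(\gamma)\le \mathbf{x}^u,\qquad K^+\boldsymbol{g}^\ell_{\mathcal{P}}+K^-\boldsymbol{g}^u_{\mathcal{P}}+\xi^\ell(\gamma)\ge \mathbf{x}^\ell,$$ where $\xi^u_i(\gamma)=\max_{\mathbf{w}\in\mathcal{W}(\gamma)}R_i\mathbf{w}$ and $\xi^\ell_i(\gamma)=\min_{\mathbf{w}\in\mathcal{W}(\gamma)}R_i\mathbf{w}$ for $i=1,\dots,|\mathbf{x}|$ ($R_i$ is the $i$-th row of $R$); (iii) $$L_t^+x_t^u+L_t^-x_t^\ell+d_t<0\qquad\text{for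 all }t=1,\dots,N.$$ Then $\mathbf{u}$ is a robust control trajectory: for every $\mathbf{w}\in\mathcal{W}(\gamma)$, the state trajectory $\mathbf{x}=(x_0,\dots,x_N)$ determined by $F(\mathbf{x},\mathbf{u},\mathbf{w})=0$ satisfies $x_t\in\mathcal{X}_t$ for all $t=1,\dots,N$.
   Context: Dynamics. Fix integers $n,m,r,N,s\ge1$, a step size $h>0$, and a map $f:\mathbb{R}^n\times\mathbb{R}^m\times\mathbb{R}^r\to\mathbb{R}^n$ that is uniformly Lipschitz in $x$ (there is $L_f\ge 0$ with $\|f(x,u,w)-f(x',u,w)\|_2\le L_f\|x-x'\|_2$ for all $x,x',u,w$) and continuous in $(u,w)$. Trajectories are stacked vectors $\mathbf{x}=(x_0,\dots,x_N)\in\mathbb{R}^{|\mathbf{x}|}$, $|\mathbf{x}|=n(N+1)$; $\mathbf{u}=(u_1,\dots,u_N)\in\mathbb{R}^{mN}$; $\mathbf{w}=(w_{\mathrm{init}},w_1,\dots,w_N)\in\mathbb{R}^{|\mathbf{w}|}$, $|\mathbf{w}|=n+rN$, with $x_t,w_{\mathrm{init}}\in\mathbb{R}^n$, $u_t\in\mathbb{R}^m$, $w_t\in\mathbb{R}^r$. $F(\mathbf{x},\mathbf{u},\mathbf{w})\in\mathbb{R}^{|\mathbf{x}|}$ is one of the following two stacked vectors: its block $0$ is $w_{\mathrm{init}}-x_0$, and its block $t$ ($t=1,\dots,N$) is $x_{t-1}+h f(x_{t-1},u_t,w_t)-x_t$ (explicit scheme), respectively $x_{t-1}+h f(x_t,u_t,w_t)-x_t$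 (implicit scheme). In the implicit case $h$ is sufficiently small, namely $hL_f<1$, so that the state trajectory is uniquely determined by $F=0$ and the Jacobian below is invertible. Linearization. A nominal trajectory $(\mathbf{x}^{(0)},\mathbf{u}^{(0)},\mathbf{w}^{(0)})$ is given; $f$ is assumed differentiable in $x$ and $w$ at the nominal points where it is evaluated. Let $J_x=\frac{\partial F}{\partial\mathbf{x}}|_{(0)}$ and $J_w=\frac{\partial F}{\partial\mathbf{w}}|_{(0)}$ be the Jacobians of $F$ at the nominal trajectory, $K=-J_x^{-1}$, $R=-J_x^{-1}J_w$, and $\boldsymbol{g}(\mathbf{x},\mathbf{u},\mathbf{w})=F(\mathbf{x},\mathbf{u},\mathbf{w})-J_x\mathbf{x}-J_w\mathbf{w}$, with $k$-th component $\boldsymbol{g}_k$. For a matrix $M$, $M^+_{ij}=\max\{M_{ij},0\}$ and $M^-_{ij}=\min\{M_{ij},0\}$. Uncertainty. $\mathcal{W}_{\mathrm{init}}(\gamma)\subseteq\mathbb{R}^n$ and $\mathcal{W}_t(\gamma)\subseteq\mathbb{R}^r$ are nonempty compact convex sets with size parameter $\gamma$; $\mathbf{w}\in\mathcal{W}(\gamma)$ means $w_{\mathrm{init}}\in\mathcal{W}_{\mathrm{init}}(\gamma)$ and $w_t\in\mathcal{W}_t(\gamma)$ for $t=1,\dots,N$. Let $\mathbf{w}^u_i=\max_{\mathbf{w}\in\mathcal{W}(\gamma)}\mathbf{w}_i$, $\mathbf{w}^\ell_i=\min_{\mathbf{w}\in\mathcal{W}(\gamma)}\mathbf{w}_i$,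 and $\partial\mathcal{W}=\{\mathbf{w}:\mathbf{w}_i\in\{\mathbf{w}_i^\ell,\mathbf{w}_i^u\}\ \forall i\}$. Tube. $\mathcal{P}(\mathbf{x}^u,\mathbf{x}^\ell)=\{\mathbf{x}:\mathbf{x}^\ell\le\mathbf{x}\le\mathbf{x}^u\}$ with $\mathbf{x}^\ell\le\mathbf{x}^u$, and $\partial\mathcal{P}=\{\mathbf{x}:\mathbf{x}_i\in\{\mathbf{x}_i^\ell,\mathbf{x}_i^u\}\ \forall i\}$. $x_t^u,x_t^\ell$ are the blocks of $\mathbf{x}^u,\mathbf{x}^\ell$ at time $t$. Envelopes. For each $k$, $\boldsymbol{g}^u_k$ is a convex function and $\boldsymbol{g}^\ell_k$ a concave function of $(\mathbf{x},\mathbf{u},\mathbf{w})$ with $\boldsymbol{g}^\ell_k\le\boldsymbol{g}_k\le\boldsymbol{g}^u_k$ on the (convex) domains $\mathcal{D}_x,\mathcal{D}_u,\mathcal{D}_w$ of state, control and uncertainty trajectories; these contain respectively the tube $\mathcal{P}(\mathbf{x}^u,\mathbf{x}^\ell)$, the control $\mathbf{u}$, and the box $\{\mathbf{w}:\mathbf{w}^\ell\le\mathbf{w}\le\mathbf{w}^u\}$. Safety. For each $t=1,\dots,N$, $\mathcal{B}_{t,1},\dots,\mathcal{B}_{t,s}\subseteq\mathbb{R}^n$ are nonempty closed convex sets (obstacles), and $\mathcal{X}_t=\mathbb{R}^n\setminus\bigcup_{i=1}^s\mathcal{B}_{t,i}$. Let $p_{t,i}=\operatorname{argmin}_{x\in\mathcal{B}_{t,i}}\|x-x_t^{(0)}\|_2^2$.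 $L_t\in\mathbb{R}^{s\times n}$ is the matrix with $i$-th row $(p_{t,i}-x_t^{(0)})^T$, and $d_t\in\mathbb{R}^s$ has $i$-th entry $-(p_{t,i}-x_t^{(0)})^Tp_{t,i}$. $\mathcal{U}_t\subseteq\mathbb{R}^m$ is the set of admissible controls at time $t$. *)

(* Defs.v *)
From HB Require Import structures.
From mathcomp Require Import all_boot all_order all_algebra.
From mathcomp Require Import all_classical all_reals all_analysis.

Set Implicit Arguments.
Unset Strict Implicit.
Unset Printing Implicit Defensive.

Import Order.TTheory GRing.Theory Num.Theory.
Import numFieldNormedType.Exports.

Local Open Scope classical_set_scope.
Local Open Scope ring_scope.

(* Vectors are row vectors, as expected by the Jacobian 'J of the library.
   Matrices keep their usual "column" meaning: the image of v under M is the
   row vector (M v)^T = v *m M^T. *)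
Definition appmx (R : realType) p q (M : 'M[R]_(p, q)) (v : 'rV[R]_q)
  : 'rV[R]_p := v *m M^T.

Definition posmx (R : realType) p q (M : 'M[R]_(p, q)) : 'M[R]_(p, q) :=
  map_mx (fun a => Num.max a 0) M.

Definition negmx (R : realType) p q (M : 'M[R]_(p, q)) : 'M[R]_(p, q) :=
  map_mx (fun a => Num.min a 0) M.

Definition lev (R : realType) p (v w : 'rV[R]_p) : Prop :=
  forall i, v 0 i <= w 0 i.

Definition ltv (R : realType) p (v w : 'rV[R]_p) : Prop :=
  forall i, v 0 i < w 0 i.

Definition dotv (R : realType) p (v w : 'rV[R]_p) : R :=
  \sum_i v 0 i * w 0 i.

(* The Euclidean norm; the library norm `|v| on matrices is the sup norm. *)
Definition norm2 (R : realType) p (v : 'rV[R]_p) : R :=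
  Num.sqrt (\sum_i v 0 i ^+ 2).

(* The maximum, the minimum and a minimizer of phi over A. Each has the junk
   value 0 when it does not exist. *)
Definition max_on (R : realType) T (A : set T) (phi : T -> R) : R :=
  xget 0 [set y | (phi @` A) y /\ ubound (phi @` A) y].

Definition min_on (R : realType) T (A : set T) (phi : T -> R) : R :=
  xget 0 [set y | (phi @` A) y /\ lbound (phi @` A) y].

Definition argmin_on (R : realType) p (A : set 'rV[R]_p) (phi : 'rV[R]_p -> R)
  : 'rV[R]_p :=
  xget 0 [set a | A a /\ forall b, A b -> phi a <= phi b].

Definition box (R : realType) p (l u : 'rV[R]_p) : set 'rV[R]_p :=
  [set v | lev l v /\ lev v u].

Definition vertices (R : realType) p (l u : 'rV[R]_p) : set 'rV[R]_p :=
  [set v | forall i, v 0 i = l 0 i \/ v 0 i = u 0 i].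

(* A stacked vector of T blocks of size p is a 'rV_(T * p), block after block. *)
Definition block (R : realType) T p (v : 'rV[R]_(T * p)) (t : 'I_T)
  : 'rV[R]_p := row t (vec_mx v).

(* The index t : 'I_N stands for the time t + 1, so that it ranges over the
   times 1, ..., N. A state trajectory has the N + 1 blocks 0, ..., N. *)
Definition cur_state (R : realType) N n (x : 'rV[R]_(N.+1 * n)) (t : 'I_N)
  : 'rV[R]_n := block x (lift ord0 t).

Definition prev_state (R : realType) N n (x : 'rV[R]_(N.+1 * n)) (t : 'I_N)
  : 'rV[R]_n := block x (widen_ord (leqnSn N) t).

Definition dist_init (R : realType) N n r (w : 'rV[R]_(n + N * r))
  : 'rV[R]_n := lsubmx w.

Definition dist (R : realType) N n r (w : 'rV[R]_(n + N * r)) (t : 'I_N)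
  : 'rV[R]_r := block (rsubmx w) t.

Inductive scheme := Explicit | Implicit.

(* The state at which f is evaluated in the step that leads to time t + 1. *)
Definition eval_state (R : realType) N n (sch : scheme)
    (x : 'rV[R]_(N.+1 * n)) (t : 'I_N) : 'rV[R]_n :=
  match sch with Explicit => prev_state x t | Implicit => cur_state x t end.

Section Dynamics.
Variables (R : realType) (N n m r : nat) (sch : scheme) (h : R).
Variable f : 'rV[R]_n -> 'rV[R]_m -> 'rV[R]_r -> 'rV[R]_n.

Definition residual (x : 'rV[R]_(N.+1 * n)) (u : 'rV[R]_(N * m))
    (w : 'rV[R]_(n + N * r)) : 'rV[R]_(N.+1 * n) :=
  mxvec (\matrix_(t < N.+1)
    match unlift ord0 t with
    | None => dist_init w - block x ord0
    | Some t' => prev_state x t'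
                 + h *: f (eval_state sch x t') (block u t') (dist w t')
                 - cur_state x t'
    end).

Variables (x0 : 'rV[R]_(N.+1 * n)) (u0 : 'rV[R]_(N * m)).
Variable w0 : 'rV[R]_(n + N * r).

Definition differentiable_nominal : Prop :=
  forall t : 'I_N,
    differentiable (fun y => f y (block u0 t) (dist w0 t))
                   (eval_state sch x0 t) /\
    differentiable (fun v => f (eval_state sch x0 t) (block u0 t) v)
                   (dist w0 t).

(* 'J is the matrix of the differential acting on row vectors, that is, the
   transpose of the matrix of partial derivatives. *)
Definition jac_x : 'M[R]_(N.+1 * n) := ('J (fun x => residual x u0 w0) x0)^T.

Definition jac_w : 'M[R]_(N.+1 * n, n + N * r) :=
  ('J (fun w => residual x0 u0 w) w0)^T.

Definition Kmx : 'M[R]_(N.+1 * n) := - invmx jac_x.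

Definition Rmx : 'M[R]_(N.+1 * n, n + N * r) := - (invmx jac_x *m jac_w).

Definition nonlinear_part (x : 'rV[R]_(N.+1 * n)) (u : 'rV[R]_(N * m))
    (w : 'rV[R]_(n + N * r)) : 'rV[R]_(N.+1 * n) :=
  residual x u w - appmx jac_x x - appmx jac_w w.

Definition robust_control (W : set 'rV[R]_(n + N * r))
    (X : 'I_N -> set 'rV[R]_n) (u : 'rV[R]_(N * m)) : Prop :=
  forall w, W w ->
    exists x, [/\ residual x u w = 0,
                  forall x', residual x' u w = 0 -> x' = x
                & forall t : 'I_N, X t (cur_state x t)].

End Dynamics.

Section Uncertainty.
Variables (R : realType) (N n r : nat).

Definition uncertainty (Winit : set 'rV[R]_n) (Wt : 'I_N -> set 'rV[R]_r)
  : set 'rV[R]_(n + N * r) :=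
  [set w | Winit (dist_init w) /\ forall t : 'I_N, Wt t (dist w t)].

Definition upper_corner p (W : set 'rV[R]_p) : 'rV[R]_p :=
  \row_i max_on W (fun w => w 0 i).

Definition lower_corner p (W : set 'rV[R]_p) : 'rV[R]_p :=
  \row_i min_on W (fun w => w 0 i).

Definition xi_upper p q (M : 'M[R]_(q, p)) (W : set 'rV[R]_p) : 'rV[R]_q :=
  \row_i max_on W (fun w => appmx M w 0 i).

Definition xi_lower p q (M : 'M[R]_(q, p)) (W : set 'rV[R]_p) : 'rV[R]_q :=
  \row_i min_on W (fun w => appmx M w 0 i).

End Uncertainty.

Section Safety.
Variables (R : realType) (n s : nat) (B : 'I_s -> set 'rV[R]_n).

Definition safe_set : set 'rV[R]_n := ~` (\bigcup_(i in [set: 'I_s]) B i).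

(* In what follows c is the nominal state at the time under consideration. *)
Definition nearest (c : 'rV[R]_n) (i : 'I_s) : 'rV[R]_n :=
  argmin_on (B i) (fun y => norm2 (y - c) ^+ 2).

Definition Lmx (c : 'rV[R]_n) : 'M[R]_(s, n) :=
  \matrix_(i < s) (nearest c i - c).

Definition dvec (c : 'rV[R]_n) : 'rV[R]_s :=
  \row_(i < s) - dotv (nearest c i - c) (nearest c i).

End Safety.

Section Envelopes.
Variables (R : realType) (p q k : nat).
Variables (Dx : set 'rV[R]_p) (Du : set 'rV[R]_q) (Dw : set 'rV[R]_k).

Definition convex_upper_envelope (phi gam : 'rV[R]_p * 'rV[R]_q * 'rV[R]_k -> R)
  : Prop :=
  convex_function (Dx `*` Du `*` Dw) gam /\
  forall z, (Dx `*` Du `*` Dw) z -> phi z <= gam z.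

Definition concave_lower_envelope
    (phi gam : 'rV[R]_p * 'rV[R]_q * 'rV[R]_k -> R) : Prop :=
  convex_function (Dx `*` Du `*` Dw) (fun z => - gam z) /\
  forall z, (Dx `*` Du `*` Dw) z -> gam z <= phi z.

End Envelopes.

(* Main.v *)
Require Import Defs.
From HB Require Import structures.
From mathcomp Require Import all_boot all_order all_algebra.
From mathcomp Require Import all_classical all_reals all_analysis.
From mathcomp Require Import ring lra.

Set Implicit Arguments.
Unset Strict Implicit.
Unset Printing Implicit Defensive.

Import Order.TTheory GRing.Theory Num.Theory.
Import numFieldNormedType.Exports.

Local Open Scope classical_set_scope.
Local Open Scope ring_scope.

(* With F = 0, the trajectory is a fixed point of the map
     G(x) = K g(x, u, w) + R w = x - J_x^-1 F(x, u, w),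
   and (i), (ii) say that G maps the tube into itself. Brouwer's theorem can be
   avoided: for suitable weights lam^t on the time blocks, - F(., u, w) is
   strongly monotone (this uses h L_f < 1 in the implicit scheme), so on the
   tube the variational inequality
     F(y)_i (z_i - y_i) <= 0  for all z in the tube and all i
   has a solution y, the fixed point of a contraction. Taking z = G(y) and
   v = - J_x^-1 F(y) gives <- J_x v, v> <= 0 in the weighted inner product. As
   a derivative of F, the matrix - J_x is positive definite for that product, so
   v = 0 and F(y) = 0. Strong monotonicity also makes y the only zero of F. *)

(** * Weighted inner products on row vectors *)

Section WeightedDot.
Variables (R : realType) (p : nat) (c : 'I_p -> R).

Definition wdot (v w : 'rV[R]_p) : R := \sum_i c i * (v 0 i * w 0 i).

Lemma wdotDl v1 v2 w : wdot (v1 + v2) w = wdot v1 w + wdot v2 w.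
Proof. by rewrite -big_split; apply: eq_bigr => i _; rewrite !mxE mulrDl mulrDr. Qed.

Lemma wdotZl k v w : wdot (k *: v) w = k * wdot v w.
Proof. by rewrite mulr_sumr; apply: eq_bigr => i _; rewrite !mxE; ring. Qed.

Lemma wdotC v w : wdot v w = wdot w v.
Proof. by apply: eq_bigr => i _; rewrite (mulrC (v 0 i)). Qed.

Lemma wdotDr v w1 w2 : wdot v (w1 + w2) = wdot v w1 + wdot v w2.
Proof. by rewrite wdotC wdotDl !(wdotC v). Qed.

Lemma wdotZr k v w : wdot v (k *: w) = k * wdot v w.
Proof. by rewrite wdotC wdotZl wdotC. Qed.

Lemma wdot0l w : wdot 0 w = 0.
Proof. by rewrite -(scale0r 0) wdotZl mul0r. Qed.

Lemma wdotNl v w : wdot (- v) w = - wdot v w.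
Proof. by rewrite -scaleN1r wdotZl mulN1r. Qed.

Lemma wdotNr v w : wdot v (- w) = - wdot v w.
Proof. by rewrite wdotC wdotNl wdotC. Qed.

Lemma wdot_sqrD t v w : wdot (v + t *: w) (v + t *: w) =
  wdot v v + 2 * (t * wdot w v) + t * (t * wdot w w).
Proof. by rewrite !(wdotDl, wdotDr, wdotZl, wdotZr) (wdotC v w); ring. Qed.

Hypothesis c_gt0 : forall i, 0 < c i.

Lemma wdot_ge0 v : 0 <= wdot v v.
Proof. by apply: sumr_ge0 => i _; rewrite mulr_ge0 ?(ltW (c_gt0 _))// -expr2 sqr_ge0. Qed.

Lemma wdot_eq0 v : wdot v v <= 0 -> v = 0.
Proof.
move=> v0; have : wdot v v == 0 by rewrite eq_le v0 wdot_ge0.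
rewrite psumr_eq0; last by move=> i _; rewrite mulr_ge0 ?(ltW (c_gt0 _))// -expr2 sqr_ge0.
move=> /allP h; apply/rowP => i; have /= := h i (mem_index_enum _).
by rewrite !mulf_eq0 gt_eqF//= orbb mxE => /eqP.
Qed.

Lemma coord_le_wdot (v : 'rV[R]_p) i : c i * v 0 i ^+ 2 <= wdot v v.
Proof.
rewrite /wdot (bigD1 i)//= expr2 lerDl.
by apply: sumr_ge0 => j _; rewrite mulr_ge0 ?(ltW (c_gt0 _))// -expr2 sqr_ge0.
Qed.

End WeightedDot.

(** * Strong monotonicity, Lipschitz bounds and fixed points *)

Section Dissipative.
Variables (R : realType) (p : nat) (c : 'I_p -> R).
Hypothesis c_gt0 : forall i, 0 < c i.
Implicit Types (F : 'rV[R]_p -> 'rV[R]_p) (l u x y v : 'rV[R]_p).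

(** That is, [- F] is strongly monotone with modulus [a] for the weighted inner product. *)
Definition dissipative a F := forall x y,
  wdot c (F x - F y) (x - y) <= - a * wdot c (x - y) (x - y).

(** Both sides are squared norms, so the Lipschitz constant is the square root of [M]. *)
Definition wlipschitz M F := forall x y,
  wdot c (F x - F y) (F x - F y) <= M * wdot c (x - y) (x - y).

Lemma dissipative_zero_unique a F x y :
  0 < a -> dissipative a F -> F x = 0 -> F y = 0 -> x = y.
Proof.
move=> a_gt0 /(_ x y) + Fx Fy; rewrite Fx Fy subrr.
rewrite wdot0l mulNr oppr_ge0 pmulr_rle0// => /wdot_eq0.
by move=> /(_ c_gt0)/eqP; rewrite subr_eq0 => /eqP.
Qed.

Lemma continuous_wdot (T : topologicalType) (f g : T -> 'rV[R]_p) :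
  (forall i, continuous (fun t => f t 0 i)) ->
  (forall i, continuous (fun t => g t 0 i)) ->
  continuous (fun t => wdot c (f t) (g t)).
Proof.
move=> cf cg; apply: (@continuous_big R _ +%R 0 xpredT) => [|i _ x].
  exact: add_continuous.
apply: cvgM; first exact: cvg_cst.
by apply: cvgM; [exact: cf|exact: cg].
Qed.

Lemma continuous_mull (T : topologicalType) (k : R) (f : T -> R) :
  continuous f -> continuous (fun t => k * f t).
Proof. by move=> cf t; apply: cvgM; [exact: cvg_cst|exact: cf]. Qed.

Lemma continuous_coordB (T : topologicalType) (f g : T -> 'rV[R]_p) i :
  continuous (fun t => f t 0 i) -> continuous (fun t => g t 0 i) ->
  continuous (fun t => (f t - g t) 0 i).
Proof.
move=> cf cg; have -> : (fun t => (f t - g t) 0 i) = fun t => f t 0 i - g t 0 i.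
  by apply/funext => z; rewrite !mxE.
by move=> z; apply: cvgB; [exact: cf|exact: cg].
Qed.

Lemma continuous_at_dominated (T : topologicalType) (f q : T -> R) (y : T) :
  {for y, continuous q} -> q y = 0 ->
  (forall t, (f t - f y) ^+ 2 <= q t) -> {for y, continuous f}.
Proof.
move=> cq q0 fq; apply/cvgrPdist_le => e e0.
have /cvgrPdist_le/(_ _ (exprn_gt0 2 e0)) := cq; apply: filterS => t.
rewrite q0 sub0r normrN => qe; rewrite distrC -(@ler_pXn2r _ 2)// ?nnegrE ?(ltW e0)//.
rewrite real_normK ?num_real//.
exact: le_trans (fq t) (le_trans (ler_norm _) qe).
Qed.

(** One squared coordinate of [F x - F y], times its weight, is at most the weighted square of the
    whole vector, hence at most [M * wdot c (x - y) (x - y)], which is continuous in [x] and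
    vanishes at [y]. *)
Lemma wlipschitz_continuous M F i :
  wlipschitz M F -> continuous (fun x => F x 0 i).
Proof.
move=> FL y.
pose q x := (c i)^-1 * (M * wdot c (x - y) (x - y)).
have cq : continuous q.
  do 2 apply: continuous_mull.
  have cxy j : continuous (fun x : 'rV[R]_p => (x - y) 0 j).
    apply: (@continuous_coordB _ id (cst y)); first exact: coord_continuous.
    exact: cst_continuous.
  exact: continuous_wdot.
have q0 : q y = 0.
  rewrite /q subrr /wdot big1 ?mulr0 // => j _.
  by rewrite !mxE !mulr0.
have Fq x : (F x 0 i - F y 0 i) ^+ 2 <= q x.
  rewrite ler_pdivlMl//.
  apply: le_trans (FL x y); apply: le_trans (coord_le_wdot c_gt0 _ i).
  by rewrite !mxE.
exact: (continuous_at_dominated (cq y) q0 Fq).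
Qed.

(* A minimizer over A of the displacement of F is a fixed point. *)
Lemma wlipschitz_fixpoint k F (A : set 'rV[R]_p) :
  0 <= k < 1 -> wlipschitz k F -> A !=set0 -> compact A ->
  (forall x, A x -> A (F x)) -> exists2 x, A x & F x = x.
Proof.
move=> /andP[k0 k1] FL A0 cA AF.
pose phi x := wdot c (F x - x) (F x - x).
have cphi : continuous phi.
  have cF i : continuous (fun x => (F x - x) 0 i).
    apply: (@continuous_coordB _ F id); last exact: coord_continuous.
    exact: wlipschitz_continuous FL.
  exact: continuous_wdot.
have [x xA xmin] := EVT_min_rV A0 cA (continuous_subspaceT cphi).
rewrite inE in xA; exists x => //.
(* Minimality and the Lipschitz bound give [phi x <= phi (F x) <= k * phi x] with [k < 1], so
   [phi x = 0]. *)
have := xmin (F x); rewrite inE => /(_ (AF _ xA)) h.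
have := le_trans h (FL (F x) x); rewrite -/(phi x) => h2.
apply/eqP; rewrite -subr_eq0; apply/eqP/(wdot_eq0 c_gt0).
rewrite -/(phi x); have := wdot_ge0 c_gt0 (F x - x); rewrite -/(phi x) => h3; nra.
Qed.

End Dissipative.

(** * Variational inequalities on a box and zeros of dissipative maps *)

Section BoxEquilibrium.
Variables (R : realType) (p : nat) (c : 'I_p -> R).
Hypothesis c_gt0 : forall i, 0 < c i.
Implicit Types (F : 'rV[R]_p -> 'rV[R]_p) (l u x y v : 'rV[R]_p).

Definition clamp (a b t : R) := Num.max a (Num.min t b).

Lemma clamp_itv a b t : a <= b -> a <= clamp a b t <= b.
Proof.
by move=> ab; rewrite /clamp; case: (leP t b) => ?;
  [case: (leP a t)|case: (leP a b)] => ?; apply/andP; split; lra.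
Qed.

Lemma clamp_contract a b s t : a <= b ->
  (clamp a b s - clamp a b t) ^+ 2 <= (s - t) ^+ 2.
Proof.
move=> ab; wlog st : s t / s <= t => [hw|].
  by have [/hw//|/ltW/hw] := leP s t; rewrite -sqrrN opprB -[leRHS]sqrrN opprB.
rewrite -sqrrN opprB -[leRHS]sqrrN opprB ler_sqr ?nnegrE ?subr_ge0//;
  rewrite /clamp; case: (leP s b) => ?; case: (leP t b) => ?; rewrite ?(max_idPr ab);
  (try case: (leP a s) => ?); (try case: (leP a t) => ?); lra.
Qed.

(** If the clamped step [t + g] returns to [t], then [g] is zero or points out of the interval at
    the endpoint [t], whereas [z - t] points inwards. *)
Lemma clamp_fixpoint a b g t z : a <= z <= b ->
  clamp a b (t + g) = t -> g * (z - t) <= 0.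
Proof.
rewrite /clamp => /andP[az zb].
by case: (leP (t + g) b) => ?; [case: (leP a (t + g))|case: (leP a b)] => ? ?; nra.
Qed.

Definition boxproj l u x : 'rV[R]_p := \row_i clamp (l 0 i) (u 0 i) (x 0 i).

Lemma compact_box l u : compact (box l u).
Proof.
have := @rV_compact R p (fun i => `[l 0 i, u 0 i]%classic)
  (fun i => @segment_compact R (l 0 i) (u 0 i)).
congr compact; apply/seteqP; split => x /= h.
  by split=> i; have := h i; rewrite /= in_itv/= => /andP[].
by move=> i; rewrite /= in_itv/= h.1 h.2.
Qed.

(* y is the fixed point of x |-> proj (x + t F(x)); the projection onto a box is
   coordinatewise, so it is nonexpansive whatever the weights c are. *)
Lemma dissipative_box_equilibrium a M F l u :
  0 < a -> 0 < M -> dissipative c a F -> wlipschitz c M F -> lev l u ->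
  exists2 y, box l u y &
    forall z i, box l u z -> F y 0 i * (z 0 i - y 0 i) <= 0.
Proof.
move=> a0 M0 Fa FM lu.
(* The squared norm of [d + t *: D] is at most [1 - 2 t a + t^2 M] times that of [d]. The bound
   [t M <= a] reduces this factor to [1 - t a], and [t <= 1 / (2 a)] keeps it nonnegative. *)
pose t := Num.min (a / M) (1 / (2 * a)).
have t0 : 0 < t by rewrite lt_min !divr_gt0 ?mulr_gt0.
pose T x := boxproj l u (x + t *: F x).
have TL : wlipschitz c (1 - t * a) T.
  move=> x y; set d := x - y; set D := F x - F y.
  have h1 : wdot c (T x - T y) (T x - T y) <= wdot c (d + t *: D) (d + t *: D).
    apply: ler_sum => i _; rewrite ler_wpM2l ?(ltW (c_gt0 _))// -!expr2.
    rewrite /T /boxproj !mxE; apply: le_trans (clamp_contract _ _ (lu i)) _.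
    by rewrite le_eqVlt; apply/orP; left; apply/eqP; ring.
  apply: le_trans h1 _; rewrite wdot_sqrD.
  have := Fa x y; have := FM x y; rewrite -/d -/D.
  have := wdot_ge0 c_gt0 d; have tM : t * M <= a.
    by rewrite -ler_pdivlMr// ge_min lexx.
  set dd := wdot c d d; set DD := wdot c D D; set Dd := wdot c D d => dd0 hM ha.
  have : t * DD <= a * dd.
    apply: le_trans (_ : t * (M * dd) <= _); first by rewrite ler_pM2l.
    by rewrite mulrA ler_wpM2r.
  move=> h; have : t * (t * DD) <= t * (a * dd) by rewrite ler_pM2l.
  have : t * Dd <= t * (- a * dd) by rewrite ler_pM2l.
  lra.
have ta : 0 <= 1 - t * a < 1.
  have : t * (2 * a) <= 1 by rewrite -ler_pdivlMr ?mulr_gt0// ge_min lexx orbT.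
  have := mulr_gt0 t0 a0; lra.
have lbox : box l u l by split.
have Tbox x : box l u x -> box l u (T x).
  by move=> _; split=> i; rewrite /T /boxproj mxE;
    have /andP[] := clamp_itv ((x + t *: F x) 0 i) (lu i).
have [y yb yT] := wlipschitz_fixpoint c_gt0 ta TL (ex_intro _ _ lbox)
  (@compact_box l u) Tbox.
exists y => // z i [lz zu]; rewrite -(pmulr_rle0 _ t0) mulrA.
apply: (@clamp_fixpoint (l 0 i) (u 0 i)); first by rewrite lz zu.
by move/rowP/(_ i): yT; rewrite /T /boxproj !mxE.
Qed.

(** A kernel vector satisfies [0 <= - a * wdot c v v], so it vanishes. This yields the invertibility
    of [J_x] in both schemes. *)
Lemma negative_definite_unitmx a (J : 'M[R]_p) : 0 < a ->
  (forall v, wdot c (appmx J v) v <= - a * wdot c v v) -> J \in unitmx.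
Proof.
move=> a0 Ja; rewrite -unitmx_tr -row_free_unit; apply/inj_row_free => v vJ0.
have := Ja v; rewrite /appmx vJ0 wdot0l mulNr oppr_ge0.
by rewrite pmulr_rle0// => /(wdot_eq0 c_gt0).
Qed.

Lemma box_zero a M F (J : 'M[R]_p) l u :
  0 < a -> 0 < M -> dissipative c a F -> wlipschitz c M F -> lev l u ->
  (forall v, wdot c (appmx J v) v <= - a * wdot c v v) ->
  (forall y, box l u y -> box l u (y - appmx (invmx J) (F y))) ->
  exists2 y, box l u y & F y = 0.
Proof.
move=> a0 M0 Fa FM lu Ja Jbox.
have Ju := negative_definite_unitmx a0 Ja.
have [y yb yF] := dissipative_box_equilibrium a0 M0 Fa FM lu.
exists y => //; pose v := - appmx (invmx J) (F y).
have Fv : F y = - appmx J v.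
  by rewrite /v /appmx mulNmx opprK -mulmxA -trmx_mul mulmxV// trmx1 mulmx1.
(* The test point is [z = y + v], which lies in the box by [Jbox]. The variational inequality holds
   in each coordinate separately, so it can be summed with the weights [c]. *)
have : wdot c (F y) v <= 0.
  apply: sumr_le0 => i _; rewrite pmulr_rle0//.
  by have := yF _ i (Jbox _ yb); rewrite mxE (addrC (y 0 i)) addrK.
rewrite {1}Fv wdotNl => h.
have v0 : v = 0.
  apply: (wdot_eq0 c_gt0); have := Ja v; have := wdot_ge0 c_gt0 v; nra.
by rewrite Fv v0 /appmx mul0mx oppr0.
Qed.

(** Dissipativity at [h *: v + x] and [x], divided by [h ^+ 2], passes to the limit [h -> 0]. The
    divisor is positive for either sign of [h]. *)
Lemma dissipative_jacobian a F x v :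
  dissipative c a F -> differentiable F x ->
  wdot c (appmx ('J F x)^T v) v <= - a * wdot c v v.
Proof.
move=> Fa dF; rewrite /appmx trmxK -deriveEjacobian//.
have dv : derivable F x v by exact: diff_derivable.
have cD : (fun h : R => wdot c (h^-1 *: (F (h *: v + x) - F x)) v) @ 0^' -->
          wdot c ('D_v F x) v.
  apply: (@cvg_big R _ +%R 0 xpredT) => [|i _]; first exact: add_continuous.
  apply: cvgM; first exact: cvg_cst.
  apply: cvgM; last exact: cvg_cst.
  exact: (cvg_comp _ _ dv (@coord_continuous R 1 p 0 i _)).
rewrite -(cvg_lim _ cD)//; apply: limr_le; first by apply/cvg_ex; eexists; exact: cD.
near=> h; have h0 : h != 0 by near: h; exact: nbhs_dnbhs_neq.
have := Fa (h *: v + x) x; rewrite addrK !(wdotZl, wdotZr).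
have h2 : 0 < h ^+ 2 by rewrite exprn_even_gt0.
move=> H; rewrite -(ler_pM2l h2) mulrA expr2 mulfK//.
by lra.
Unshelve. all: by end_near. Qed.

End BoxEquilibrium.

(** * Euclidean inner product and Young-type inequalities *)

Section Dotv.
Variables (R : realType) (p : nat).
Implicit Types (v w e d : 'rV[R]_p).

Lemma dotvE v w : dotv v w = wdot (fun=> 1) v w.
Proof. by apply: eq_bigr => i _; rewrite mul1r. Qed.

Lemma dotv_ge0 v : 0 <= dotv v v.
Proof. by rewrite dotvE wdot_ge0. Qed.

Lemma dotvC v w : dotv v w = dotv w v.
Proof. by rewrite !dotvE wdotC. Qed.

Lemma dotvDl v1 v2 w : dotv (v1 + v2) w = dotv v1 w + dotv v2 w.
Proof. by rewrite !dotvE wdotDl. Qed.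

Lemma dotvBl v1 v2 w : dotv (v1 - v2) w = dotv v1 w - dotv v2 w.
Proof. by rewrite dotvDl !dotvE wdotNl. Qed.

Lemma dotvZl k v w : dotv (k *: v) w = k * dotv v w.
Proof. by rewrite !dotvE wdotZl. Qed.

Lemma norm2_sqr v : norm2 v ^+ 2 = dotv v v.
Proof.
by rewrite sqr_sqrtr ?sumr_ge0// => i _; exact: sqr_ge0.
Qed.

Lemma dotv_sqrD t v w :
  dotv (v + t *: w) (v + t *: w) = dotv v v + 2 * (t * dotv w v) + t * (t * dotv w w).
Proof. by rewrite !dotvE wdot_sqrD. Qed.

Lemma dotv_young t v w : 2 * (t * dotv v w) <= dotv v v + t * (t * dotv w w).
Proof.
have := dotv_ge0 (v + (- t) *: w); rewrite dotv_sqrD (dotvC w v).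
by rewrite !mulNr !mulrN opprK; lra.
Qed.

Lemma dotv_norm2_le L v w : 0 <= L -> norm2 v <= L * norm2 w ->
  dotv v v <= L ^+ 2 * dotv w w.
Proof.
move=> L0 vw; rewrite -!norm2_sqr -exprMn ler_sqr// nnegrE ?sqrtr_ge0//.
by rewrite mulr_ge0 ?sqrtr_ge0.
Qed.

(* Young's inequality with parameter L, which gives the sharp constant needed
   for the condition h L_f < 1. *)
Lemma dotv_norm2_le_lin L v w : 0 <= L -> norm2 v <= L * norm2 w ->
  dotv v w <= L * dotv w w.
Proof.
move=> L0 vw; have h := dotv_norm2_le L0 vw; have y := dotv_young L v w.
have [L_eq0|Ln0] := eqVneq L 0.
  have v0 : v = 0.
    apply: (@wdot_eq0 _ _ (fun=> 1)) => //; rewrite -dotvE.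
    by move: h; rewrite L_eq0 expr2 !mul0r.
  by rewrite v0 L_eq0 mul0r dotvE wdot0l.
have Lp : 0 < L by rewrite lt_neqAle eq_sym Ln0.
by rewrite -(ler_pM2l Lp); move: h; rewrite expr2; lra.
Qed.

(** The two sides differ by the sum of the squared norms of [e - v], [e + d] and [v + d]. *)
Lemma dotv_sqr_sub3 e v d :
  dotv (e + v - d) (e + v - d) <= 3 * (dotv e e + dotv v v + dotv d d).
Proof.
rewrite !mulrDr /dotv !mulr_sumr -!big_split; apply: ler_sum => i _.
have := sqr_ge0 (e 0 i - v 0 i); have := sqr_ge0 (e 0 i + d 0 i).
by have := sqr_ge0 (v 0 i + d 0 i); rewrite !mxE !expr2 /=; lra.
Qed.

End Dotv.

(** * One-step estimates for the residual *)

Section Residual.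
Variables (R : realType) (N n m r : nat) (sch : scheme) (h : R).
Variables (f : 'rV[R]_n -> 'rV[R]_m -> 'rV[R]_r -> 'rV[R]_n) (Lf : R).
Hypotheses (h_gt0 : 0 < h) (Lf_ge0 : 0 <= Lf).
Hypothesis f_lip : forall x x' u w,
  norm2 (f x u w - f x' u w) <= Lf * norm2 (x - x').
Hypothesis h_small : sch = Implicit -> h * Lf < 1.
Implicit Types (x y : 'rV[R]_(N.+1 * n)) (u : 'rV[R]_(N * m)).
Implicit Types (w : 'rV[R]_(n + N * r)) (t : 'I_N).

Lemma blockE T p (v : 'rV[R]_(T * p)) i j :
  block v i 0 j = v 0 (mxvec_index i j).
Proof. by rewrite !mxE. Qed.

Lemma blockB T p (v w : 'rV[R]_(T * p)) i : block (v - w) i = block v i - block w i.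
Proof. by apply/rowP => j; rewrite !(blockE, mxE). Qed.

Lemma block_residual0 x u w :
  block (residual sch h f x u w) ord0 = dist_init w - block x ord0.
Proof.
by apply/rowP => j; rewrite /residual /block mxvecK !mxE unlift_none !mxE.
Qed.

Lemma block_residualS x u w t :
  block (residual sch h f x u w) (lift ord0 t) =
  prev_state x t + h *: f (eval_state sch x t) (block u t) (dist w t)
    - cur_state x t.
Proof.
apply/rowP => j; rewrite /residual /block mxvecK /cur_state !mxE.
by rewrite liftK !mxE.
Qed.

(** The term [- cur_state] of the residual provides the decay in [d]. The previous state contributes
    through Young's inequality with a possibly large factor [b], to be absorbed later by the weights
    on the time blocks. *)
Lemma residual_step : exists a b M : R, [/\ 0 < a <= 1, 0 <= b, 1 <= M &
  forall x y u w t,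
  let D := block (residual sch h f x u w - residual sch h f y u w) (lift ord0 t) in
  let d := cur_state (x - y) t in
  let d' := prev_state (x - y) t in
  dotv D d <= b * dotv d' d' - a * dotv d d /\
  dotv D D <= M * (dotv d' d' + dotv d d)].
Proof.
have h0 := ltW h_gt0; have hL0 : 0 <= h * Lf by rewrite mulr_ge0.
have blockD x y u w t (k := f (eval_state sch x t) (block u t) (dist w t) -
                            f (eval_state sch y t) (block u t) (dist w t)) :
    block (residual sch h f x u w - residual sch h f y u w) (lift ord0 t) =
    prev_state (x - y) t + h *: k - cur_state (x - y) t.
  rewrite blockB !block_residualS /cur_state /prev_state !blockB scalerBr.
  by apply/rowP => j; rewrite !mxE; ring.
have evalB x y t : eval_state sch (x - y) t = eval_state sch x t - eval_state sch y t.
  by case: sch; apply: blockB.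
have M1 : 1 <= 3 * (1 + (h * Lf) ^+ 2) by have := sqr_ge0 (h * Lf); lra.
(* Allowing both [e] and [d] in the bound on [v] covers the two schemes at once. *)
have main (e v d : 'rV[R]_n) : dotv v v <= (h * Lf) ^+ 2 * (dotv e e + dotv d d) ->
    dotv (e + v - d) (e + v - d) <=
      3 * (1 + (h * Lf) ^+ 2) * (dotv e e + dotv d d).
  by move=> hv; have := @dotv_sqr_sub3 R n e v d; lra.

have lipE x y u w t (k := f (eval_state sch x t) (block u t) (dist w t) -
                          f (eval_state sch y t) (block u t) (dist w t)) :
    norm2 k <= Lf * norm2 (eval_state sch (x - y) t).
  by rewrite evalB; exact: f_lip.
have sqE (k e : 'rV[R]_n) : norm2 k <= Lf * norm2 e ->
    dotv (h *: k) (h *: k) <= (h * Lf) ^+ 2 * dotv e e.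
  move=> /(dotv_norm2_le Lf_ge0) kE; rewrite dotvZl (dotvC k) dotvZl.
  have : (h * h) * dotv k k <= (h * h) * (Lf ^+ 2 * dotv e e).
    by rewrite ler_pM2l// mulr_gt0.
  by rewrite !expr2; lra.
case: sch lipE blockD h_small => /= lipE blockD hs.
(* Here [D = d' + v - d] with [v] controlled by [d']. Young with parameter 1/2 costs a quarter of
   [dotv d d] for each of the two cross terms, which leaves [a = 1/2]. *)
- exists 2^-1, (1 + (h * Lf) ^+ 2), (3 * (1 + (h * Lf) ^+ 2)).
  have L2 := sqr_ge0 (h * Lf).
  split => //; [by apply/andP; split; lra|by lra|move=> x y u w t /=].
  set D := block _ _; set d := cur_state _ t; set d' := prev_state _ t.
  have kE := sqE _ _ (lipE x y u w t).
  rewrite /D blockD -/d -/d'; move: kE; rewrite -/d'; set v := h *: _ => kE.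
  have := dotv_ge0 d; have := dotv_ge0 d' => d0' d0; split.
    have := dotv_young 2^-1 d' d; have := dotv_young 2^-1 v d.
    by rewrite dotvBl dotvDl; lra.
  apply: main; apply: le_trans kE _; rewrite ler_wpM2l//; lra.
- have a0 : 0 < 1 - h * Lf by rewrite subr_gt0 hs.
  set a := 1 - h * Lf in a0.
  (* The increment of [f] is now controlled by [d] itself, and the decay left is
     [a = 1 - h * Lf > 0]. Young with parameter [a] spends half of it on the cross term with
     [d']. *)
  exists (a / 2), (a^-1 / 2), (3 * (1 + (h * Lf) ^+ 2)).
  have ai : 0 < a^-1 by rewrite invr_gt0.
  have L2 := sqr_ge0 (h * Lf).
  have a1 : a <= 1 by rewrite /a; lra.
  split => //; [by apply/andP; split; lra|by lra|move=> x y u w t /=].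
  set D := block _ _; set d := cur_state _ t; set d' := prev_state _ t.
  have kE := sqE _ _ (lipE x y u w t).
  have := dotv_norm2_le_lin Lf_ge0 (lipE x y u w t).
  rewrite /D blockD -/d -/d'; move: kE; rewrite -/d; set k := _ - _ => kE kl.
  have := dotv_ge0 d; have := dotv_ge0 d' => d0' d0; split; last first.
    by apply: main; apply: le_trans kE _; rewrite ler_wpM2l//; lra.
  have y1 := dotv_young a d' d.
  have y2 : 2 * dotv d' d <= a^-1 * dotv d' d' + a * dotv d d.
    rewrite -(ler_pM2l a0) mulrDr (mulrA a a^-1) mulfV ?gt_eqF// mul1r.
    by apply: le_trans y1; rewrite le_eqVlt; apply/orP; left; apply/eqP; ring.
  have y3 : h * dotv k d <= h * (Lf * dotv d d) by rewrite ler_pM2l.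
  by rewrite dotvBl dotvDl dotvZl; rewrite /a in y2 *; lra.
Qed.

End Residual.

(** * Weights constant on time blocks *)

Section BlockWeights.
Variables (R : realType).

Definition block_weight T p (mu : 'I_T -> R) (i : 'I_(T * p)) : R :=
  mxvec (\matrix_(t < T, j < p) mu t) 0 i.

Lemma block_weight_gt0 T p (mu : 'I_T -> R) i :
  (forall t, 0 < mu t) -> 0 < @block_weight T p mu i.
Proof. by move=> mu0; case/mxvec_indexP: i => t j; rewrite /block_weight mxvecE mxE. Qed.

Lemma wdot_block T p (mu : 'I_T -> R) (v w : 'rV[R]_(T * p)) :
  wdot (block_weight mu) v w = \sum_t mu t * dotv (block v t) (block w t).
Proof.
rewrite /wdot (reindex _ (curry_mxvec_bij _ _)) /=.
under [RHS]eq_bigr do rewrite /dotv mulr_sumr.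
rewrite pair_bigA /=; apply: eq_bigr => -[t j] _ /=.
by rewrite /block_weight mxvecE !mxE.
Qed.

End BlockWeights.

(** * Dissipativity and differentiability of the residual *)

Section ResidualDissipative.
Variables (R : realType) (N n m r : nat) (sch : scheme) (h : R).
Variables (f : 'rV[R]_n -> 'rV[R]_m -> 'rV[R]_r -> 'rV[R]_n) (Lf : R).
Hypotheses (h_gt0 : 0 < h) (Lf_ge0 : 0 <= Lf).
Hypothesis f_lip : forall x x' u w,
  norm2 (f x u w - f x' u w) <= Lf * norm2 (x - x').
Hypothesis h_small : sch = Implicit -> h * Lf < 1.

(** With geometric weights [lam ^+ t], the contribution of the previous block at time [t + 1] is
    small compared with the decay already available at time [t]. The weights and constants do not
    depend on [u] and [w], so they serve both the nominal trajectory, for the Jacobian, and the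
    actual one. *)
Lemma residual_dissipative : exists (c : 'I_(N.+1 * n) -> R) (a M : R),
  [/\ forall i, 0 < c i, 0 < a, 0 < M &
  forall (u : 'rV[R]_(N * m)) (w : 'rV[R]_(n + N * r)),
    dissipative c a (fun x => residual sch h f x u w) /\
    wlipschitz c M (fun x => residual sch h f x u w)].
Proof.
have [a [b [M [/andP[a0 a1] b0 M1 step]]]] :=
  @residual_step R N n m r sch h f Lf h_gt0 Lf_ge0 f_lip h_small.
(* Chosen so that [lam * b <= a / 2]; the [1 +] keeps the denominator positive when [b = 0] and
   gives [lam <= 1]. *)
pose lam := a / (2 * (1 + b)).
have b1 : 0 < 1 + b by lra.
have lam0 : 0 < lam by rewrite divr_gt0// mulr_gt0.
have lamb : lam * b <= a / 2.
  by rewrite /lam mulrAC ler_pdivrMr ?mulr_gt0//; nra.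
have lam1 : lam <= 1 by rewrite /lam ler_pdivrMr ?mulr_gt0//; lra.
exists (block_weight (fun t => lam ^+ t)), (a / 2), (2 * M).
split; [by move=> i; apply: block_weight_gt0 => t; exact: exprn_gt0|lra|lra|].
move=> u w.
(* The previous states are the blocks 0 to N - 1, so only the last term on the right is dropped. *)
have prev_le (d : 'rV[R]_(N.+1 * n)) :
    \sum_(t < N) lam ^+ t * dotv (prev_state d t) (prev_state d t) <=
    \sum_(t < N.+1) lam ^+ t * dotv (block d t) (block d t).
  by rewrite [leRHS]big_ord_recr /= lerDl mulr_ge0 ?dotv_ge0// exprn_ge0// (ltW lam0).
have S0 (d : 'rV[R]_n) := dotv_ge0 d.
split=> x y; rewrite !wdot_block; have := prev_le (x - y); set P := \sum_(t < N) _;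
  rewrite !big_ord_recl /= !mul1r.
  set D0 := dotv (block (x - y) ord0) _; set S := \sum_(i < N) _ => PS.
  have -> : dotv (block (residual sch h f x u w - residual sch h f y u w) ord0)
      (block (x - y) ord0) = - D0.
    rewrite blockB !block_residual0 /D0 blockB.
    set e := _ - _; have -> : e = - (block x ord0 - block y ord0).
      by apply/rowP => j; rewrite !mxE; ring.
    by rewrite !dotvE wdotNl.
  (* One factor [lam] of [lam ^+ i.+1] absorbs [b]; the remaining [lam ^+ i] is the weight of the
     previous block. *)
  have : \sum_(i < N) lam ^+ i.+1 *
      dotv (block (residual sch h f x u w - residual sch h f y u w) (lift ord0 i))
        (block (x - y) (lift ord0 i)) <= a / 2 * P - a * S.
    rewrite !mulr_sumr -sumrB; apply: ler_sum => t _.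
    have [st _] := step x y u w t.
    have lt0 : 0 < lam ^+ t := exprn_gt0 _ lam0.
    apply: le_trans (ler_wpM2l (exprn_ge0 t.+1 (ltW lam0)) st) _.
    rewrite /bump /= add1n exprS.
    have := S0 (prev_state (x - y) t); set pp := dotv (prev_state _ t) _ => pp0.
    have : (lam * b) * (lam ^+ t * pp) <= a / 2 * (lam ^+ t * pp).
      by rewrite ler_wpM2r// mulr_ge0// (ltW lt0).
    rewrite /cur_state; set cc := dotv _ _; lra.
  have D00 : 0 <= D0 := S0 _.
  (* Since [P <= D0 + S] and [a <= 1], the total [- D0 + a / 2 * P - a * S] is at most
     [- (a / 2) * (D0 + S)]. *)
  rewrite /bump /=; nra.
set D0 := dotv (block (x - y) ord0) _; set S := \sum_(i < N) _ => PS.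
have -> : dotv (block (residual sch h f x u w - residual sch h f y u w) ord0)
    (block (residual sch h f x u w - residual sch h f y u w) ord0) = D0.
  rewrite blockB !block_residual0 /D0 blockB.
  set e := _ - _; have -> : e = - (block x ord0 - block y ord0).
    by apply/rowP => j; rewrite !mxE; ring.
  by rewrite !dotvE wdotNl wdotNr opprK.
have D00 : 0 <= D0 := S0 _.
have S00 : 0 <= S.
  by apply: sumr_ge0 => t _; rewrite mulr_ge0 ?S0// exprn_ge0// (ltW lam0).
(* The factor [2 * M] comes from [P <= D0 + S] and [1 <= M]. *)
apply: le_trans (_ : D0 + M * (P + S) <= _); last by nra.
rewrite lerD2l mulrDr !mulr_sumr -big_split; apply: ler_sum => t _ /=.
have [_ st] := step x y u w t.
apply: le_trans (ler_wpM2l (exprn_ge0 t.+1 (ltW lam0)) st) _.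
rewrite /bump /= add1n exprS.
have lt0 : 0 < lam ^+ t := exprn_gt0 _ lam0.
have := S0 (prev_state (x - y) t); set pp := dotv (prev_state _ t) _ => pp0.
have : lam * (M * (lam ^+ t * pp)) <= 1 * (M * (lam ^+ t * pp)).
  by rewrite ler_wpM2r// mulr_ge0 ?mulr_ge0 ?(ltW lt0)//; lra.
rewrite /cur_state; set cc := dotv _ _; lra.
Qed.

Lemma differentiable_rV (V : normedModType R) p (g : V -> 'rV[R]_p) x :
  (forall i, differentiable (fun y => g y 0 i) x) -> differentiable g x.
Proof.
move=> dg; have -> : g = \sum_(i < p) (fun y => g y 0 i *: delta_mx 0 i : 'rV[R]_p).
  by apply/funext => y; rewrite fct_sumE [LHS]row_sum_delta.
by apply: differentiable_sum => i; exact: differentiableZl.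
Qed.

Lemma residual_differentiable (x0 : 'rV[R]_(N.+1 * n)) (u0 : 'rV[R]_(N * m))
    (w0 : 'rV[R]_(n + N * r)) :
  differentiable_nominal sch f x0 u0 w0 ->
  differentiable (fun x => residual sch h f x u0 w0) x0.
Proof.
move=> fd.
have coordx k : differentiable (fun x : 'rV[R]_(N.+1 * n) => x 0 k) x0.
  exact: differentiable_coord.
have dblock t : differentiable (fun x : 'rV[R]_(N.+1 * n) => block x t) x0.
  apply: differentiable_rV => j.
  by under eq_fun do rewrite blockE; exact: coordx.
have deval t : differentiable (fun x => eval_state sch x t) x0.
  by case: sch; exact: dblock.
apply: differentiable_rV => k; case/mxvec_indexP: k => t j.
under eq_fun do rewrite -blockE.
apply: (@differentiable_comp _ _ _ _ _ (fun v : 'rV[R]_n => v 0 j)); last first.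
  exact: differentiable_coord.
case: (unliftP ord0 t) => [t'|] ->.
  under eq_fun do rewrite block_residualS.
  apply: differentiableB; last exact: dblock.
  apply: differentiableD; first exact: dblock.
  apply: differentiableZ.
  apply: (@differentiable_comp _ _ _ _ _
    (fun y => f y (block u0 t') (dist w0 t'))); first exact: deval.
  exact: (fd t').1.
under eq_fun do rewrite block_residual0.
by apply: differentiableB; [exact: differentiable_cst|exact: dblock].
Qed.

End ResidualDissipative.

(** * Convex functions on boxes are bounded by their values at vertices *)

Section ConvexVertices.
Variables (R : realType).

(** Induction on the number of coordinates of [v] that are not at an endpoint: [v] is a convex
    combination of the two points obtained by moving one such coordinate to either endpoint. *)
Lemma convex_le_vertices p (phi : 'rV[R]_p -> R) (l u : 'rV[R]_p) C :
  (forall x y t, box l u x -> box l u y -> 0 <= t <= 1 ->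
     phi (t *: x + (1 - t) *: y) <= t * phi x + (1 - t) * phi y) ->
  (forall v, vertices l u v -> phi v <= C) ->
  forall v, box l u v -> phi v <= C.
Proof.
move=> phic phiv v.
pose inner (v : 'rV[R]_p) := [set i | (v 0 i != l 0 i) && (v 0 i != u 0 i)]%SET.
have [k] := ubnP #|inner v|; elim: k v => // k IH v; rewrite ltnS => vk vbox.
have [inner0|[i]] := set_0Vmem (inner v).
  apply: phiv => i; have : i \notin inner v by rewrite inner0 inE.
  by rewrite inE negb_and !negbK => /orP[]/eqP->; [left|right].
move=> iv; have := iv; rewrite inE => /andP[vl vu].
have [/(_ i) lv /(_ i) uv] := vbox.
have {vl}lv : l 0 i < v 0 i by rewrite lt_neqAle eq_sym vl.
have {vu}uv : v 0 i < u 0 i by rewrite lt_neqAle vu.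
pose upd (a : R) : 'rV[R]_p := \row_j if j == i then a else v 0 j.
have updbox a : l 0 i <= a <= u 0 i -> box l u (upd a).
  by move=> /andP[la au]; split=> j; rewrite mxE; case: eqP => [->|_] //; apply vbox.
have updle a : a = l 0 i \/ a = u 0 i -> l 0 i <= a <= u 0 i -> phi (upd a) <= C.
  move=> alu la; apply: IH (updbox _ la); apply: leq_trans vk.
  apply/proper_card/fintype.properP; split.
    apply/fintype.subsetP => j; rewrite !inE !mxE; have [->|_ //] := eqVneq j i.
    by case: alu => ->; rewrite eqxx ?andbF.
  by exists i => //; rewrite !inE !mxE eqxx; case: alu => ->; rewrite eqxx ?andbF.
have lu : l 0 i <= u 0 i by lra.
have hl : phi (upd (l 0 i)) <= C by apply: updle; [left|rewrite lexx].
have hu : phi (upd (u 0 i)) <= C by apply: updle; [right|rewrite lexx andbT].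
have d0 : 0 < u 0 i - l 0 i by lra.
pose t := (u 0 i - v 0 i) / (u 0 i - l 0 i).
have t01 : 0 <= t <= 1.
  by rewrite /t divr_ge0 ?ler_pdivrMr//=; lra.
have -> : v = t *: upd (l 0 i) + (1 - t) *: upd (u 0 i).
  apply/rowP => j; rewrite !mxE; case: eqP => [->|_]; last by ring.
  by rewrite /t; field; rewrite gt_eqF.
have lbox : box l u (upd (l 0 i)) by apply: updbox; rewrite lexx.
have ubox : box l u (upd (u 0 i)) by apply: updbox; rewrite lexx andbT.
apply: le_trans (phic _ _ _ lbox ubox t01) _; move/andP: t01 => [t0 t1]; nra.
Qed.

Lemma convex_functionE (E : lmodType R) (D : set E) (g : E -> R) x y (t : R) :
  convex_function D g -> D x -> D y -> 0 <= t <= 1 ->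
  g (t *: x + (1 - t) *: y) <= t * g x + (1 - t) * g y.
Proof.
move=> gc Dx Dy /andP[t0 t1].
exact: (gc (Itv01 t0 t1) x y (mem_set Dx) (mem_set Dy)).
Qed.

(** The vertex bound is applied first in [w] with [x] fixed, then in [x] with [w] at a vertex. Joint
    convexity restricts to each variable because [t *: z + (1 - t) *: z = z]. *)
Lemma convex_le_vertices2 p q k (Dx : set 'rV[R]_p) (Du : set 'rV[R]_q)
    (Dw : set 'rV[R]_k) (g : 'rV[R]_p * 'rV[R]_q * 'rV[R]_k -> R) xl xu wl wu u C :
  convex_function (Dx `*` Du `*` Dw) g -> Du u ->
  box xl xu `<=` Dx -> box wl wu `<=` Dw ->
  (forall x w, vertices xl xu x -> vertices wl wu w -> g (x, u, w) <= C) ->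
  forall x w, box xl xu x -> box wl wu w -> g (x, u, w) <= C.
Proof.
move=> gc uD xD wD gv x w xbox wbox.
have vbox n (l v z : 'rV[R]_n) : box l v z -> vertices l v `<=` box l v.
  move=> [lz zv] z' z'v; have lv i : l 0 i <= v 0 i := le_trans (lz i) (zv i).
  by split=> i; case: (z'v i) => ->.
have conv3 x1 x2 w1 w2 t : Dx x1 -> Dx x2 -> Dw w1 -> Dw w2 -> 0 <= t <= 1 ->
    g (t *: x1 + (1 - t) *: x2, u, t *: w1 + (1 - t) *: w2) <=
    t * g (x1, u, w1) + (1 - t) * g (x2, u, w2).
  move=> Dx1 Dx2 Dw1 Dw2 t01.
  have := @convex_functionE _ _ g (x1, u, w1) (x2, u, w2) t gc.
  move=> /(_ (conj (conj Dx1 uD) Dw1) (conj (conj Dx2 uD) Dw2) t01).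
  congr (g _ <= _); congr (_, _, _).
  by rewrite /= -scalerDl addrC subrK scale1r.
have conv1 k' (z : 'rV[R]_k') t : t *: z + (1 - t) *: z = z.
  by rewrite -scalerDl addrC subrK scale1r.
apply: (@convex_le_vertices _ (fun w => g (x, u, w)) wl wu) =>
  [w1 w2 t b1 b2 t01|w' w'v|//].
  by rewrite -{1}(conv1 _ x t) conv3//; [exact: xD|exact: xD|exact: wD|exact: wD].
have w'b := vbox _ _ _ _ wbox _ w'v.
apply: (@convex_le_vertices _ (fun x => g (x, u, w')) xl xu) =>
  [x1 x2 t b1 b2 t01|x' x'v|//].
  by rewrite -{1}(conv1 _ w' t) conv3//; [exact: xD|exact: xD|exact: wD|exact: wD].
exact: gv.
Qed.

End ConvexVertices.

(** * Extrema over compact sets and compactness of the uncertainty set *)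

Section MaxOn.
Variable R : realType.

(** By compactness the maximum is attained, which excludes the default value 0 of [xget]; likewise
    for the minimum below. *)
Lemma max_onP (T : topologicalType) (A : set T) (phi : T -> R) :
  A !=set0 -> compact A -> continuous phi ->
  forall t, A t -> phi t <= max_on A phi.
Proof.
move=> A0 cA cphi t At; rewrite /max_on; case: xgetP => [y _ [_ yub]|].
  by apply: yub; exists t.
have [z zA zmax] := compact_EVT_max A0 cA (continuous_subspaceT cphi).
move=> /(_ (phi z)); case; split; first by exists z => //; exact: set_mem.
by move=> _ [s As <-]; apply: zmax; exact: mem_set.
Qed.

Lemma min_onP (T : topologicalType) (A : set T) (phi : T -> R) :
  A !=set0 -> compact A -> continuous phi ->
  forall t, A t -> min_on A phi <= phi t.
Proof.
move=> A0 cA cphi t At; rewrite /min_on; case: xgetP => [y _ [_ ylb]|].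
  by apply: ylb; exists t.
have [z zA zmin] := compact_EVT_min A0 cA (continuous_subspaceT cphi).
move=> /(_ (phi z)); case; split; first by exists z => //; exact: set_mem.
by move=> _ [s As <-]; apply: zmin; exact: mem_set.
Qed.

Lemma continuous_appmx p q (M : 'M[R]_(q, p)) i :
  continuous (fun w => appmx M w 0 i).
Proof.
have -> : (fun w => appmx M w 0 i) = fun w => wdot (fun=> 1) w (row i M).
  by apply/funext => w; rewrite mxE; apply: eq_bigr => j _; rewrite !mxE mul1r.
apply: continuous_wdot => j; first exact: coord_continuous.
exact: cst_continuous.
Qed.

Lemma compact_coord_bounds p (A : set 'rV[R]_p) i : A !=set0 -> compact A ->
  exists a b, forall v, A v -> a <= v 0 i <= b.
Proof.
move=> A0 cA; have ci : continuous (fun v : 'rV[R]_p => v 0 i).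
  exact: coord_continuous.
exists (min_on A (fun v => v 0 i)), (max_on A (fun v => v 0 i)) => v Av.
by rewrite (min_onP A0 cA ci Av) (max_onP A0 cA ci Av).
Qed.

(** The set is an intersection of preimages of closed sets under the block projections, hence
    closed, and its coordinates are bounded by those of the compact factors, so it lies in a compact
    box. *)
Lemma compact_uncertainty N n r (Winit : set 'rV[R]_n) (Wt : 'I_N -> set 'rV[R]_r) :
  Winit !=set0 -> (forall t, Wt t !=set0) ->
  compact Winit -> (forall t, compact (Wt t)) -> compact (uncertainty Winit Wt).
Proof.
move=> Wi0 Wt0 cWi cWt.
have bnd (k : 'I_(n + N * r)) : exists ab : R * R,
    forall w, uncertainty Winit Wt w -> ab.1 <= w 0 k <= ab.2.
  case: (split_ordP k) => [i|k'] ->.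
    have [a [b ab]] := compact_coord_bounds i Wi0 cWi.
    by exists (a, b) => w [/ab + _]; rewrite mxE.
  case/mxvec_indexP: k' => t j.
  have [a [b ab]] := compact_coord_bounds j (Wt0 t) (cWt t).
  by exists (a, b) => w [_ /(_ t)/ab]; rewrite /dist blockE mxE.
have [ab abP] := choice bnd.
apply: (@subclosed_compact _ _ (box (\row_k (ab k).1) (\row_k (ab k).2))).
- have cdist t : continuous (fun w : 'rV[R]_(n + N * r) => dist w t).
    move=> w; apply: differentiable_continuous; apply: differentiable_rV => j.
    under eq_fun do rewrite /dist blockE mxE.
    exact: differentiable_coord.
  have -> : uncertainty Winit Wt =
      lsubmx @^-1` Winit `&` \bigcap_(t in setT) ((fun w => dist w t) @^-1` Wt t).
    by apply/seteqP; split => w [Wi Wt']; split => // t; [move=> _|]; exact: Wt'.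
  apply: closedI.
    apply: preimage_closed => [w _|]; first exact: continuous_lsubmx.
    exact: compact_closed (@norm_hausdorff _ _) cWi.
  apply: closed_bigI => t _; apply: preimage_closed => [w _|]; first exact: cdist.
  exact: compact_closed (@norm_hausdorff _ _) (cWt t).
- exact: compact_box.
- by move=> w Ww; split=> k; have /andP[] := abP k w Ww; rewrite !mxE.
Qed.

Lemma uncertainty_nonempty N n r (Winit : set 'rV[R]_n) (Wt : 'I_N -> set 'rV[R]_r) :
  Winit !=set0 -> (forall t, Wt t !=set0) -> uncertainty Winit Wt !=set0.
Proof.
move=> [wi wiW] /choice[wt wtW].
exists (row_mx wi (mxvec (\matrix_t wt t))); split.
  by rewrite /dist_init row_mxKl.
by move=> t; rewrite /dist row_mxKr /block mxvecK rowK.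
Qed.

End MaxOn.

(** * Interval bounds for a linear map *)

Section IntervalArithmetic.
Variable R : realType.

(** Each product [M i j * v 0 j] is monotone in [v 0 j], in the direction given by the sign of
    [M i j]; the positive and negative parts select the right endpoint. *)
Lemma appmx_box p q (M : 'M[R]_(q, p)) l u v i : box l u v ->
  appmx (posmx M) l 0 i + appmx (negmx M) u 0 i <= appmx M v 0 i <=
  appmx (posmx M) u 0 i + appmx (negmx M) l 0 i.
Proof.
move=> [lv vu]; rewrite !mxE -!big_split /=.
have cases j : (0 <= M i j /\ Num.max (M i j) 0 = M i j /\ Num.min (M i j) 0 = 0) \/
    (M i j <= 0 /\ Num.max (M i j) 0 = 0 /\ Num.min (M i j) 0 = M i j).
  by case: (leP 0 (M i j)) => [|/ltW] h; [left|right].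
apply/andP; split; apply: ler_sum => j _; rewrite !mxE;
  have := lv j; have := vu j => ? ?; case: (cases j) => -[? [-> ->]]; nra.
Qed.

End IntervalArithmetic.

(** * Projection onto a closed convex obstacle *)

Section Nearest.
Variables (R : realType) (n s : nat) (B : 'I_s -> set 'rV[R]_n) (c : 'rV[R]_n).
Variable i : 'I_s.
Hypotheses (B0 : B i !=set0) (Bclosed : closed (B i)) (Bconvex : convex_set (B i)).

(** Points farther from [c] than some [b0] in the set can be discarded; what remains lies in a
    compact part [K], where the distance attains its minimum. *)
Lemma nearestP : B i (nearest B c i) /\
  forall b, B i b -> norm2 (nearest B c i - c) ^+ 2 <= norm2 (b - c) ^+ 2.
Proof.
rewrite /nearest /argmin_on; case: xgetP => [a _ //|].
(* With this [r], a number whose square is at most [r - 1] has absolute value at most [r], which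
   avoids a square root. *)
have [b0 b0B] := B0; pose r := 1 + norm2 (b0 - c) ^+ 2.
pose K := B i `&` box (\row_j (c 0 j - r)) (\row_j (c 0 j + r)).
have r1 : 1 <= r by rewrite lerDl sqr_ge0.
have coord (b : 'rV[R]_n) j : (b 0 j - c 0 j) ^+ 2 <= norm2 (b - c) ^+ 2.
  rewrite norm2_sqr dotvE; have := @coord_le_wdot R n (fun=> 1) (fun=> ltr01) (b - c) j.
  by rewrite mul1r !mxE.
have small (b : 'rV[R]_n) : norm2 (b - c) ^+ 2 <= norm2 (b0 - c) ^+ 2 ->
    box (\row_j (c 0 j - r)) (\row_j (c 0 j + r)) b.
  move=> bb0; split=> j; have := le_trans (coord b j) bb0;
    rewrite !mxE => hb; rewrite /r in r1 *; nra.
have K0 : K !=set0 by exists b0; split => //; exact: small.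
have cK : compact K by rewrite /K setIC; apply: compact_closedI => //; exact: compact_box.
have cphi : continuous (fun y : 'rV[R]_n => norm2 (y - c) ^+ 2).
  have -> : (fun y : 'rV[R]_n => norm2 (y - c) ^+ 2) =
            fun y => wdot (fun=> 1) (y - c) (y - c).
    by apply/funext => y; rewrite norm2_sqr dotvE.
  by apply: continuous_wdot => j; apply: (@continuous_coordB _ _ _ id (cst c));
    (exact: coord_continuous || exact: cst_continuous).
have [a /set_mem aK amin] := EVT_min_rV K0 cK (continuous_subspaceT cphi).
move=> /(_ a); case; split; first exact: aK.1.
have ab0 := amin b0 (mem_set (conj b0B (small _ (lexx _)))).
move=> b bB; have [bb0|/ltW] := leP (norm2 (b - c) ^+ 2) (norm2 (b0 - c) ^+ 2).
  by apply: amin; rewrite inE; split => //; exact: small.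
exact: le_trans.
Qed.

(** The hyperplane through the nearest point, normal to its offset from [c], has the whole obstacle
    on its far side: otherwise a small move from the nearest point towards [b] would come closer to
    [c]. *)
Lemma nearest_obtuse b : B i b -> 0 <= dotv (nearest B c i - c) (b - nearest B c i).
Proof.
move=> bB; have [pB pmin] := nearestP.
set p := nearest B c i in pB pmin *; rewrite dotvC.
set d := dotv _ _; rewrite leNgt; apply/negP => d0.
pose q := dotv (b - p) (b - p); have q0 : 0 <= q := dotv_ge0 _.
(* This step lies in (0, 1], also when [q = 0], and satisfies [t * q <= - d], so that
   [2 * d + t * q <= d < 0]. *)
pose t := - d / (- d + q).
have dq : 0 < - d + q by lra.
have t0 : 0 < t by rewrite divr_gt0; lra.
have t1 : t <= 1 by rewrite ler_pdivrMr; lra.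
have ptB : B i (t *: b + (1 - t) *: p).
  exact/set_mem/(Bconvex (Itv01 (ltW t0) t1) (mem_set bB) (mem_set pB)).
have := pmin _ ptB; rewrite !norm2_sqr.
have -> : t *: b + (1 - t) *: p - c = p - c + t *: (b - p).
  by apply/rowP => j; rewrite !mxE; ring.
rewrite dotv_sqrD -/d -/q => h.
have : 0 <= t * (2 * d + t * q) by lra.
rewrite pmulr_rge0// => h2.
have tq : t * q <= - d by rewrite /t mulrAC ler_pdivrMr; nra.
lra.
Qed.

End Nearest.

(** * Robustness of the control trajectory *)

Theorem theorem4 (R : realType) (n m r N s : nat)
  (n_gt0 : (0 < n)%N) (m_gt0 : (0 < m)%N) (r_gt0 : (0 < r)%N)
  (N_gt0 : (0 < N)%N) (s_gt0 : (0 < s)%N)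
  (* dynamics *)
  (sch : scheme) (h : R) (h_gt0 : 0 < h)
  (f : 'rV[R]_n -> 'rV[R]_m -> 'rV[R]_r -> 'rV[R]_n)
  (Lf : R) (Lf_ge0 : 0 <= Lf)
  (f_lip : forall x x' u w,
     norm2 (f x u w - f x' u w) <= Lf * norm2 (x - x'))
  (f_cont : forall x,
     continuous (fun uw : 'rV[R]_m * 'rV[R]_r => f x uw.1 uw.2))
  (h_small : sch = Implicit -> h * Lf < 1)
  (* nominal trajectory *)
  (x0 : 'rV[R]_(N.+1 * n)) (u0 : 'rV[R]_(N * m)) (w0 : 'rV[R]_(n + N * r))
  (f_diff : differentiable_nominal sch f x0 u0 w0)
  (* uncertainty *)
  (Winit : R -> set 'rV[R]_n) (Wt : R -> 'I_N -> set 'rV[R]_r) (gamma : R)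
  (Winit_nonempty : Winit gamma !=set0)
  (Winit_compact : compact (Winit gamma))
  (Winit_convex : convex_set (Winit gamma))
  (Wt_nonempty : forall t, Wt gamma t !=set0)
  (Wt_compact : forall t, compact (Wt gamma t))
  (Wt_convex : forall t, convex_set (Wt gamma t))
  (* envelopes *)
  (Dx : set 'rV[R]_(N.+1 * n)) (Du : set 'rV[R]_(N * m))
  (Dw : set 'rV[R]_(n + N * r))
  (Dx_convex : convex_set Dx) (Du_convex : convex_set Du)
  (Dw_convex : convex_set Dw)
  (gu gl : 'I_(N.+1 * n) ->
     'rV[R]_(N.+1 * n) * 'rV[R]_(N * m) * 'rV[R]_(n + N * r) -> R)
  (gu_envelope : forall k, convex_upper_envelope Dx Du Dw
     (fun z => nonlinear_part sch h f x0 u0 w0 z.1.1 z.1.2 z.2 0 k) (gu k))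
  (gl_envelope : forall k, concave_lower_envelope Dx Du Dw
     (fun z => nonlinear_part sch h f x0 u0 w0 z.1.1 z.1.2 z.2 0 k) (gl k))
  (* obstacles and admissible controls *)
  (B : 'I_N -> 'I_s -> set 'rV[R]_n)
  (B_nonempty : forall t i, B t i !=set0)
  (B_closed : forall t i, closed (B t i))
  (B_convex : forall t i, convex_set (B t i))
  (U : 'I_N -> set 'rV[R]_m)
  (* control trajectory *)
  (u : 'rV[R]_(N * m)) (u_admissible : forall t, U t (block u t))
  (u_dom : Du u) :
  let W := uncertainty (Winit gamma) (Wt gamma) in
  let wu := upper_corner W in
  let wl := lower_corner W in
  let K := Kmx sch h f x0 u0 w0 in
  let Rm := Rmx sch h f x0 u0 w0 in
  box wl wu `<=` Dw ->
  (exists xu xl gPu gPl : 'rV[R]_(N.+1 * n),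
     [/\ lev xl xu, box xl xu `<=` Dx,
         (* (i) *)
         forall k x w, vertices xl xu x -> vertices wl wu w ->
           gu k (x, u, w) <= gPu 0 k /\ gPl 0 k <= gl k (x, u, w),
         (* (ii) *)
         lev (appmx (posmx K) gPu + appmx (negmx K) gPl + xi_upper Rm W) xu /\
         lev xl (appmx (posmx K) gPl + appmx (negmx K) gPu + xi_lower Rm W)
       & (* (iii) *)
         forall t : 'I_N,
           let Lt := Lmx (B t) (cur_state x0 t) in
           let dt := dvec (B t) (cur_state x0 t) in
           ltv (appmx (posmx Lt) (cur_state xu t)
                + appmx (negmx Lt) (cur_state xl t) + dt) 0]) ->
  robust_control sch h f W (fun t => safe_set (B t)) u.
Proof.
move=> W wu wl K Rm wDw [xu [xl [gPu [gPl [lxu xD gP [hu hl] hs]]]]] w Ww.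
have [c [a [M [c0 a0 M0 Fdis]]]] :=
  @residual_dissipative R N n m r sch h f Lf h_gt0 Lf_ge0 f_lip h_small.
have [Fa FM] := Fdis u w.
set J := jac_x sch h f x0 u0 w0; set Jw := jac_w sch h f x0 u0 w0.
(* The Jacobian is taken at the nominal [u0], [w0], yet it is definite for the same weights [c] as
   the residual at [u], [w]. *)
have Ja v : wdot c (appmx J v) v <= - a * wdot c v v.
  by apply: dissipative_jacobian (Fdis u0 w0).1 _; exact: residual_differentiable.
have Ju := negative_definite_unitmx c0 a0 Ja.
have W0 : W !=set0 by exact: uncertainty_nonempty.
have cW : compact W by exact: compact_uncertainty.
have wbox : box wl wu w.
  have ck k : continuous (fun v : 'rV[R]_(n + N * r) => v 0 k) by exact: coord_continuous.
  by split=> k; rewrite mxE; [exact: min_onP|exact: max_onP].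
(* Condition (i) extends from the vertices to the tube and the box by convexity of [gu k] and of
   [- gl k]. *)
have gbox y : box xl xu y -> box gPl gPu (nonlinear_part sch h f x0 u0 w0 y u w).
  move=> ybox; have yuwD : (Dx `*` Du `*` Dw) (y, u, w).
    by split; [split => //; exact: xD|exact: wDw].
  split=> k.
    have [glc gle] := gl_envelope k; apply: le_trans (gle _ yuwD).
    rewrite -lerN2; apply: (convex_le_vertices2 glc u_dom xD wDw _ ybox wbox).
    by move=> x' w' x'v w'v; rewrite lerN2; exact: (gP k _ _ x'v w'v).2.
  have [guc gue] := gu_envelope k; apply: le_trans (gue _ yuwD) _.
  apply: (convex_le_vertices2 guc u_dom xD wDw _ ybox wbox).
  by move=> x' w' x'v w'v; exact: (gP k _ _ x'v w'v).1.
(* Writing the residual as [g + J y + Jw w], the term [J y] cancels [y]. *)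
have stepE y : y - appmx (invmx J) (residual sch h f y u w) =
    appmx K (nonlinear_part sch h f x0 u0 w0 y u w) + appmx Rm w.
  set g := nonlinear_part _ _ _ _ _ _ _ _ _.
  have -> : residual sch h f y u w = g + appmx J y + appmx Jw w.
    by rewrite /g /nonlinear_part -/J -/Jw addrAC subrK subrK.
  rewrite /appmx /K /Rm /Kmx /Rmx -/J -/Jw !linearN /=.
  rewrite !mulmxDl -!mulmxA -!trmx_mul mulVmx// trmx1 mulmx1.
  by rewrite !opprD addrA addrCA addrN addr0.
have [y ybox Fy] : exists2 y, box xl xu y & residual sch h f y u w = 0.
  apply: (box_zero c0 a0 M0 Fa FM lxu Ja) => y ybox; rewrite stepE.
  have Kg i := appmx_box K i (gbox y ybox).
  have xi i : appmx Rm w 0 i <= xi_upper Rm W 0 i.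
    by rewrite [leRHS]mxE; apply: (max_onP W0 cW) => //; exact: continuous_appmx.
  have xi' i : xi_lower Rm W 0 i <= appmx Rm w 0 i.
    by rewrite [leLHS]mxE; apply: (min_onP W0 cW) => //; exact: continuous_appmx.
  split=> i; have /andP[K1 K2] := Kg i.
    by apply: le_trans (hl i) _; rewrite 2!mxE [leRHS]mxE lerD.
  by apply: le_trans _ (hu i); rewrite mxE [leRHS]mxE lerD// [leRHS]mxE.
exists y; split => // [x' Fx'|t].
  exact: (dissipative_zero_unique c0 a0 Fa Fx' Fy).
(* If the state were in obstacle [i], [nearest_obtuse] would make entry [i] of [L_t x_t + d_t]
   nonnegative, while interval arithmetic and (iii) make it negative. *)
move=> [i _ yB]; have := hs t i.
have ytbox : box (cur_state xl t) (cur_state xu t) (cur_state y t).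
  by split=> j; rewrite !blockE; apply ybox.
have /andP[_ yL] := appmx_box (Lmx (B t) (cur_state x0 t)) i ytbox.
have := nearest_obtuse (cur_state x0 t) (B_nonempty t i) (@B_closed t i)
  (@B_convex t i) yB.
set p := nearest _ _ _; rewrite dotvC dotvBl.
have -> : dotv (cur_state y t) (p - cur_state x0 t) =
    appmx (Lmx (B t) (cur_state x0 t)) (cur_state y t) 0 i.
  by rewrite [RHS]mxE; apply: eq_bigr => j _; rewrite !mxE.
have -> : dotv p (p - cur_state x0 t) = - dvec (B t) (cur_state x0 t) 0 i.
  by rewrite [in RHS]mxE opprK dotvC.
rewrite 2![in X in _ -> X -> _]mxE [X in _ -> _ < X -> _]mxE; lra.
Qed.
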